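(* Let $\mathcal{H}$ be an infinite dimensional complex Hilbert space, let $m\geq 1$ be an integer, and let $T\in B(\mathcal{H})$ be an algebraic $m$-expansive operator such that its spectral radius satisfies $r(T)\leq 1$. Then: (i) $T$ is a perturbation of a unitary by a commuting nilpotent, i.e. $T=U+N$ with $U\in B(\mathcal{H})$ unitary, $N\in B(\mathcal{H})$ nilpotent and $UN=NU$; (ii) there exist positive integers $m_0$ and $n$, with $m_0\leq m$, $m_0$ odd and $n\geq \frac{m_0+1}{2}$, such that $T$ is $(2n-1)$-isometric.
   Context: $B(\mathcal{H})$ is the algebra of bounded linear operators on $\mathcal{H}$. For $T\in B(\mathcal{H})$ and an integer $k\ge 1$ put $\triangle_{T^*,T}^k(I)=\sum_{j=0}^k(-1)^j\binom{k}{j}{T^*}^jT^j$. $T$ is $k$-expansive if $\triangle_{T^*,T}^k(I)\le 0$ and $k$-isometric if $\triangle_{T^*,T}^k(I)=0$. $T$ is algebraic if $q(T)=0$ for some nonzero polynomial $q$. *)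

(* Defs.v *)
From HB Require Import structures.
From mathcomp Require Import all_boot all_order all_algebra.
From mathcomp Require Import all_classical all_reals all_analysis.
From mathcomp Require Import complex ring lra.

Set Implicit Arguments.
Unset Strict Implicit.
Unset Printing Implicit Defensive.

Import Order.TTheory GRing.Theory Num.Theory.
Import numFieldNormedType.Exports.

Local Open Scope classical_set_scope.
Local Open Scope complex_scope.
Local Open Scope ring_scope.

(* The inner product is linear in its first argument, conjugate-linear in the
   second one, and positive definite (see {dot _ for _} in sesquilinear). *)
HB.mixin Record CompleteNormedModule_isHilbert (R : realType) H
    of CompleteNormedModule R[i] H := {
  inner : {dot H for @Num.conj R[i]} ;
  inner_xx : forall x : H, inner x x = `|x| ^+ 2
}.

#[short(type="hilbertType")]
HB.structure Definition Hilbert (R : realType) :=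
  {H of CompleteNormedModule_isHilbert R H & CompleteNormedModule R[i] H}.

Section InfiniteDimensional.
Context {R : realType}.

Definition finite_dimensional (H : hilbertType R) : Prop :=
  exists (n : nat) (e : 'I_n -> H),
    forall x, exists c : 'I_n -> R[i], x = \sum_i c i *: e i.

Definition infinite_dimensional (H : hilbertType R) : Prop :=
  ~ finite_dimensional H.

End InfiniteDimensional.

Section BoundedOperators.
Context {R : realType} (H : hilbertType R).
Local Notation C := R[i].

Definition bounded_linear : {pred H -> H} := fun f =>
  `[< linear f /\ exists M : C, forall x, `|f x| <= M * `|x| >].

Record bop := Bop { bop_fun :> H -> H ; _ : bop_fun \in bounded_linear }.

HB.instance Definition _ := [isSub for bop_fun].
HB.instance Definition _ := [Choice of bop by <:].

Lemma bounded_linearP (f : H -> H) : reflect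
  (linear f /\ exists2 M : C, 0 <= M & forall x, `|f x| <= M * `|x|)
  (f \in bounded_linear).
Proof.
apply: (iffP idP).
  move=> /asboolP[lf [M fM]]; split=> //.
  exists `|M| => // x; have := fM x.
  have [->|x0] := eqVneq x 0; first by rewrite normr0 !mulr0.
  move=> /[dup] fMx /(le_trans (normr_ge0 _)).
  by rewrite pmulr_lge0 ?normr_gt0// => /ger0_norm ->.
by move=> [lf [M _ fM]]; apply/asboolP; split => //; exists M.
Qed.

Lemma bounded_linear_submod : submod_closed bounded_linear.
Proof.
split.
  apply/bounded_linearP; split; first by move=> a x y; rewrite scaler0 addr0.
  by exists 0 => // x; rewrite normr0 mul0r.
move=> a f g /bounded_linearP[lf [M M0 fM]] /bounded_linearP[lg [N N0 gN]].
apply/bounded_linearP; split.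
  move=> b x y.
  rewrite -[LHS]/(a *: f (b *: x + y) + g (b *: x + y)) lf lg.
  rewrite -[in RHS]/(b *: (a *: f x + g x) + (a *: f y + g y)).
  by rewrite !scalerDr !scalerA [b * a]mulrC addrACA.
exists (`|a| * M + N); first by rewrite addr_ge0// mulr_ge0.
move=> x; rewrite (le_trans (ler_normD _ _))// mulrDl lerD//.
by rewrite normrZ -mulrA ler_wpM2l.
Qed.

HB.instance Definition _ :=
  GRing.isSubmodClosed.Build C (H -> H) bounded_linear bounded_linear_submod.
HB.instance Definition _ := [SubChoice_isSubLmodule of bop by <:].

Lemma bop1_subproof : (@idfun H) \in bounded_linear.
Proof.
apply/bounded_linearP; split=> //.
by exists 1 => // x; rewrite mul1r.
Qed.

Lemma bopM_subproof (S T : bop) : (S \o T : H -> H) \in bounded_linear.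
Proof.
have /bounded_linearP[lS [M M0 SM]] := valP S.
have /bounded_linearP[lT [N N0 TN]] := valP T.
apply/bounded_linearP; split.
  by move=> a x y; rewrite /= -[bop_fun T]/(\val T) lT; exact: lS.
exists (M * N); first exact: mulr_ge0.
by move=> x /=; rewrite (le_trans (SM _))// -mulrA ler_wpM2l.
Qed.

Definition bop1 : bop := Bop bop1_subproof.
Definition bop_mul (S T : bop) : bop := Bop (bopM_subproof S T).

Lemma bop_linear (T : bop) : linear T.
Proof. by have /bounded_linearP[] := valP T. Qed.

HB.instance Definition _ (T : bop) :=
  GRing.isLinear.Build C H H *:%R (bop_fun T) (bop_linear T).

Lemma bop_bounded (T : bop) :
  exists2 M : C, 0 <= M & forall x, `|T x| <= M * `|x|.
Proof. by have /bounded_linearP[] := valP T. Qed.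

Lemma bopE (S T : bop) : (forall x, S x = T x) -> S = T.
Proof. by move=> ST; apply/val_inj/funext. Qed.

Fact bop_mulA : associative bop_mul. Proof. by move=> ? ? ?; exact: bopE. Qed.
Fact bop_mul1l : left_id bop1 bop_mul. Proof. by move=> ?; exact: bopE. Qed.
Fact bop_mul1r : right_id bop1 bop_mul. Proof. by move=> ?; exact: bopE. Qed.
Fact bop_mulDl : left_distributive bop_mul +%R.
Proof. by move=> ? ? ?; exact: bopE. Qed.
Fact bop_mulDr : right_distributive bop_mul +%R.
Proof. by move=> S T U; apply: bopE => x; exact: (linearD S). Qed.

HB.instance Definition _ := GRing.Zmodule_isPzRing.Build bop
  bop_mulA bop_mul1l bop_mul1r bop_mulDl bop_mulDr.

Fact bop_scaleAl (a : C) (S T : bop) : a *: (S * T) = a *: S * T.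
Proof. exact: bopE. Qed.
Fact bop_scaleAr (a : C) (S T : bop) : a *: (S * T) = S * (a *: T).
Proof. by apply: bopE => x; rewrite -[RHS]/(S (a *: T x)) linearZ. Qed.

End BoundedOperators.

Section Riesz.
Context {R : realType} {H : hilbertType R}.
Implicit Types (x y z h : H) (a : R).

Let N x : R := complex.Re `|x|.
Let p x y : R := complex.Re (inner x y).

Let normE x : `|x| = (N x)%:C.
Proof. by rewrite /N RRe_real// normr_real. Qed.

Let N_ge0 x : 0 <= N x.
Proof. by rewrite -lecR -normE; exact: normr_ge0. Qed.

Let pxx x : p x x = N x ^+ 2.
Proof. rewrite /p inner_xx normE -rmorphXn. by []. Qed.

Let pC x y : p x y = p y x.
Proof.
rewrite /p hermC expr0 mul1r -[LHS]/(complex.Re (conjc (inner y x))).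
by case: (inner y x).
Qed.

Let pDl x y z : p (x + y) z = p x z + p y z.
Proof. by rewrite /p linearDl raddfD. Qed.

Let ReZ a (w : R[i]) : complex.Re (a%:C * w) = a * complex.Re w.
Proof. by case: w => u v; rewrite -[LHS]/(a * u - 0 * v) mul0r subr0. Qed.

Let pZl a x y : p (a%:C *: x) y = a * p x y.
Proof. rewrite /p linearZl_LR; exact: ReZ. Qed.

Let pDr x y z : p z (x + y) = p z x + p z y.
Proof. by rewrite pC pDl ![p _ z]pC. Qed.

Let pZr a x y : p y (a%:C *: x) = a * p y x.
Proof. by rewrite pC pZl pC. Qed.

Let pNr x y : p y (- x) = - p y x.
Proof. by rewrite /p linearNr raddfN. Qed.

Let ND x y : N (x + y) ^+ 2 = N x ^+ 2 + N y ^+ 2 + 2 * p x y.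
Proof. by rewrite -!pxx pDl !pDr (pC y x); ring. Qed.

Let NN x : N (- x) = N x.
Proof. by rewrite /N normrN. Qed.

Let NZ a x : N (a%:C *: x) ^+ 2 = a ^+ 2 * N x ^+ 2.
Proof. by rewrite -!pxx pZl pZr mulrA. Qed.

Let CS x y : `|p x y| <= N x * N y.
Proof.
have key : p x y ^+ 2 <= N x ^+ 2 * N y ^+ 2.
  have [N0|N0] := eqVneq (N y) 0.
    have -> : y = 0 by apply/eqP; rewrite -normr_eq0 normE N0.
    by rewrite /p linear0r expr0n/= mulr_ge0 ?sqr_ge0.
  have Ny : 0 < N y ^+ 2 by rewrite exprn_gt0// lt0r N0 N_ge0.
  have := sqr_ge0 (N (x + (- (p x y / N y ^+ 2))%:C *: y)).
  rewrite ND NZ pZr.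
  have -> : N x ^+ 2 + (- (p x y / N y ^+ 2)) ^+ 2 * N y ^+ 2 +
    2 * (- (p x y / N y ^+ 2) * p x y) = N x ^+ 2 - p x y ^+ 2 / N y ^+ 2.
    by field.
  by rewrite subr_ge0 ler_pdivrMr.
rewrite -(@ler_pXn2r _ 2)// ?nnegrE ?mulr_ge0//.
by rewrite real_normK ?num_real// exprMn.
Qed.

Let cauchy_aux (a b s t c d : R) : a < c / 4 -> b < c / 4 ->
  s < d + a -> t < d + b -> 2 * t + 2 * s - 4 * d < c.
Proof. lra. Qed.

Lemma inner_le x y : `|inner x y| <= `|x| * `|y|.
Proof.
have [->|w0] := eqVneq (inner x y) 0; first by rewrite normr0 mulr_ge0.
rewrite -(@ler_pM2l _ `|inner x y|) ?normr_gt0//.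
have -> : `|inner x y| * `|inner x y| = (p ((inner x y)^* *: x) y)%:C.
  rewrite -expr2 sqr_normc mulrC /p linearZl_LR RRe_real//.
  by rewrite ger0_real// mulrC mulcJ_ge0.
have := CS ((inner x y)^* *: x) y.
move=> /(le_trans (ler_norm _)); rewrite -lecR => /le_trans; apply.
rewrite (_ : (_ * _)%:C = (N ((inner x y)^* *: x))%:C * (N y)%:C).
  by rewrite -!normE normrZ normcJ mulrA.
exact: rmorphM.
Qed.

Lemma riesz (phi : H -> R[i]) : scalar phi ->
  (exists M : R, forall x, `|phi x| <= M%:C * `|x|) ->
  exists z, forall x, phi x = inner x z.
Proof.
move=> lphi [M phiM].
have phiD x y : phi (x + y) = phi x + phi y.
  by have := lphi 1 x y; rewrite scale1r mul1r.
have phi0 : phi 0 = 0 by have := phiD 0 0; rewrite addr0 => /esym/eqP;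
  rewrite -subr_eq0 addrK => /eqP.
have phiZ (a : R[i]) x : phi (a *: x) = a * phi x.
  by have := lphi a x 0; rewrite !addr0 phi0 addr0.
pose f x : R := complex.Re (phi x).
have fD x y : f (x + y) = f x + f y by rewrite /f phiD raddfD.
have fZ a x : f (a%:C *: x) = a * f x.
  by rewrite /f phiZ.
have fM x : f x <= M * N x.
  rewrite -lecR (_ : (_ * _)%:C = M%:C * (N x)%:C); last exact: rmorphM.
  rewrite -normE; apply: le_trans (phiM x).
  by apply: le_trans (normc_ge_Re _); rewrite lecR ler_norm.
pose J x := N x ^+ 2 - 2 * f x.
have J_ge x : - M ^+ 2 <= J x.
  have := fM x; have := sqr_ge0 (N x - M); rewrite /J; nra.
have infJ : has_inf (range J).
  by split; [exists (J 0), 0|exists (- M ^+ 2) => _ [x _ <-]].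
pose d := inf (range J).
have dJ x : d <= J x by apply: ge_inf; [case: infJ|exists x].
have uP n : exists x, J x < d + n.+1%:R^-1.
  have [|_ [x _ <-] Jx] := @inf_adherent _ (range J) n.+1%:R^-1 _ infJ.
    by rewrite invr_gt0.
  by exists x.
have [u Ju] := choice uP.
have JB x y : N (x - y) ^+ 2 <= 2 * J x + 2 * J y - 4 * d.
  have := dJ ((2^-1)%:C *: (x + y)).
  rewrite /J NZ fZ fD !ND NN pNr; lra.
have [z uz] : exists z, u @ \oo --> z.
  suff /cauchy_cvg : cauchy (u @ \oo) by move=> /cvg_ex.
  apply/cauchy_exP => _/posnumP[e].
  have e0 : (0 : R[i]) < e%:num by [].
  have eE : e%:num = (complex.Re e%:num)%:C by rewrite RRe_real// gtr0_real.
  have r0 : 0 < complex.Re e%:num ^+ 2 / 4.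
    by rewrite divr_gt0// exprn_gt0// -ltcR -eE.
  have [K _ hK] := near_infty_natSinv_lt (PosNum r0).
  exists (u K); exists K => // n /= Kn.
  rewrite -ball_normE /= eE normE ltcR -(@ltr_pXn2r _ 2)// ?nnegrE//; last first.
    by rewrite ltW// -ltcR -eE.
  apply: (le_lt_trans (JB _ _)).
  have := Ju K; have := Ju n; have := hK K (leqnn K); have := hK n Kn.
  exact: cauchy_aux.
have g_ge0 h : 0 <= N h ^+ 2 + 2 * (p h z - f h).
  apply/ler_addgt0Pl => e e0.
  have e20 : 0 < e / 2 by rewrite divr_gt0.
  have [K1 _ hK1] := near_infty_natSinv_lt (PosNum e20).
  have c0 : (0 : R[i]) < (e / (4 * (N h + 1)))%:C.
    by rewrite ltcR divr_gt0// mulr_gt0// ltr_wpDl.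
  have /cvgrPdist_lt/(_ _ c0) [K2 _ hK2] := uz.
  pose n := maxn K1 K2.
  have := hK1 n (leq_maxl _ _); have := hK2 n (leq_maxr _ _) => /=.
  rewrite normE ltcR ltr_pdivlMr; last by rewrite mulr_gt0// ltr_wpDl.
  have := dJ (u n + h); have := Ju n; rewrite /J ND fD (pC (u n)).
  have := CS h (z - u n); rewrite pDr pNr ler_norml => /andP[+ _].
  have := N_ge0 h; have := N_ge0 (z - u n).
  move: (N (z - u n)) (N h) n.+1%:R^-1 => q r s; nra.
have g0 h : p h z = f h.
  apply/eqP; rewrite -subr_eq0; apply/eqP; set g := _ - _.
  have D0 : 0 < N h ^+ 2 + 1 by rewrite ltr_wpDl// sqr_ge0.
  have := g_ge0 ((- (g / (N h ^+ 2 + 1)))%:C *: h).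
  rewrite NZ pZl fZ.
  have -> : (- (g / (N h ^+ 2 + 1))) ^+ 2 * N h ^+ 2 +
     2 * (- (g / (N h ^+ 2 + 1)) * p h z - - (g / (N h ^+ 2 + 1)) * f h) =
     - (g ^+ 2 * (N h ^+ 2 + 2)) / (N h ^+ 2 + 1) ^+ 2.
    by rewrite /g; field; rewrite gt_eqF.
  rewrite ler_pdivlMr ?exprn_gt0// mul0r oppr_ge0 pmulr_lle0; last first.
    by rewrite ltr_wpDl// sqr_ge0.
  move=> g2; apply/eqP; rewrite -sqrf_eq0 eq_le g2 sqr_ge0//.
exists z => x; apply/eqP; rewrite eq_complex; apply/andP; split; apply/eqP.
  by rewrite -[LHS]/(f x) -g0.
have ReI (w : R[i]) : complex.Re ('i * w) = - complex.Im w.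
  by case: w => a b; rewrite -[LHS]/(0 * a - 1 * b) mul0r mul1r sub0r.
have := g0 ('i *: x); rewrite /p /f phiZ linearZl_LR.
by move=> /(etrans (esym (ReI _))) /esym /(etrans (esym (ReI _))) /oppr_inj.
Qed.

Lemma inner_inj (y z : H) : (forall x, inner x y = inner x z) -> y = z.
Proof.
move=> yz; apply/eqP; rewrite -subr_eq0 -normr_eq0 -sqrf_eq0 -inner_xx.
rewrite (_ : inner _ _ = inner (y - z) y - inner (y - z) z).
  by rewrite yz subrr.
exact: linearBr.
Qed.

End Riesz.

Section Adjoint.
Context {R : realType} {H : hilbertType R}.

Definition is_adjoint (T S : bop H) : Prop :=
  forall x y, inner (T x) y = inner x (S y).

Lemma adjoint_exists (T : bop H) : exists S : bop H, is_adjoint T S.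
Proof.
have [M M0 TM] := bop_bounded T.
have /choice[S TS] y : exists z, forall x, inner (T x) y = inner x z.
  apply: riesz => [a u v|]; first by rewrite linearP linearPl.
  exists (complex.Re (M * `|y|)) => x.
  rewrite RRe_real; last by rewrite ger0_real// mulr_ge0.
  by rewrite (le_trans (inner_le _ _))// mulrAC ler_wpM2r.
have Sbl : S \in @bounded_linear R H.
  apply/bounded_linearP; split=> [a u v|].
    apply: inner_inj => x; rewrite -TS !linearPr.
    by congr (_ * _ + _); exact: TS.
  exists M => // y.
  have [->|Sy0] := eqVneq (S y) 0; first by rewrite normr0 mulr_ge0.
  rewrite -(@ler_pM2l _ `|S y|) ?normr_gt0//.
  rewrite -expr2 -inner_xx -TS -[leLHS]ger0_norm; last first.
    by rewrite TS inner_xx exprn_ge0.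
  rewrite (le_trans (inner_le _ _))// mulrCA mulrA ler_wpM2r//.
by exists (Bop Sbl) => x y; exact: TS.
Qed.

Definition adjoint (T : bop H) : bop H := xget 0 [set S | is_adjoint T S].

Lemma adjointP (T : bop H) : is_adjoint T (adjoint T).
Proof. exact: (xgetPex 0 (adjoint_exists T)). Qed.

End Adjoint.

Section Operators.
Context {R : realType} {H : hilbertType R}.
Local Notation C := R[i].
Implicit Types (T : bop H) (k : nat) (z : C).

Definition bop_triangle k T : bop H :=
  \sum_(j < k.+1) ((-1) ^+ j * 'C(k, j)%:R : C) *: (adjoint T ^+ j * T ^+ j).

(* The order of R[i] only compares numbers with the same imaginary part, so
   the inequality also says that the quadratic form is real-valued. *)
Definition bop_le0 T : Prop := forall x : H, inner (T x) x <= 0.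

Definition k_expansive k T : Prop := bop_le0 (bop_triangle k T).

Definition k_isometric k T : Prop := bop_triangle k T = 0.

(* bop H is not known to be a nontrivial ring, hence is not an algType, and
   horner_alg does not apply. *)
Definition bop_horner (q : {poly C}) T : bop H :=
  \sum_(i < size q) q`_i *: T ^+ i.

Definition bop_algebraic T : Prop :=
  exists2 q : {poly C}, q != 0 & bop_horner q T = 0.

Definition bop_invertible T : Prop := exists S : bop H, S * T = 1 /\ T * S = 1.

Definition bop_spectrum T : set C := [set z | ~ bop_invertible (T - z *: (1 : bop H))].

(* Extended-real supremum: the real supremum of an unbounded set would be 0. *)
Definition spectral_radius T : \bar R :=
  ereal_sup [set (complex.Re `|z|)%:E | z in bop_spectrum T].

Definition bop_unitary T : Prop := adjoint T * T = 1 /\ T * adjoint T = 1.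

Definition bop_nilpotent T : Prop := exists k : nat, T ^+ k = 0.

End Operators.

(* Main.v *)
Require Import Defs.
From mathcomp Require Import all_boot all_order all_algebra.
From mathcomp Require Import all_classical all_reals all_analysis.
From mathcomp Require Import complex.
From mathcomp Require Import ring lra.
Local Open Scope ring_scope.

(** Write D_k = sum_j (-1)^j binom(k, j) T*^j T^j, B_k(x, y) = <D_k x, y>
    ([tform]), and V_c(k) = ker (T - c)^k ([gker]). The forms satisfy
    B_{k+1}(x, y) = B_k(x, y) - B_k(T x, T y) ([tformS]), and the proof shows
    that T is in fact m-isometric.

    Since T is algebraic, H is spanned by finitely many of the spaces V_c(k)
    ([primary_ind]). If T v = c v with v <> 0, then (1 - |c|^2)^m |v|^2 <= 0
    by m-expansivity and |c| <= 1 by the bound on the spectral radius, hence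
    |c| = 1 ([expansive_eigenvalue]).

    D_m vanishes on each V_c(k) ([tform_gker]), by induction on k: let x be
    in V_c(k+1). As D_m kills V_c(k) and T acts as c modulo V_c(k), the value
    B_m(y, y) is invariant under T on V_c(k+1). As c <> 0, T maps V_c(k+1)
    onto itself, so x has a backward orbit: x = y_0, T y_{n+1} = y_n. The m-th
    difference of the sequence |y_n|^2 is then the constant B_m(x, x) <= 0.
    A nonnegative sequence cannot have a negative constant as its m-th
    difference ([backward_differences_ge0]), so B_m(x, x) = 0, and D_m x = 0
    because D_m is negative semidefinite ([tform_kernel]).

    Thus D_m = 0. For |a| = |b| = 1 and a <> b, the spaces V_a(i) and V_b(j)
    are orthogonal ([gker_orthogonal]): by induction on i + j,
    0 = B_m(x, y) = (1 - a conj(b))^m <x, y>. Let U be a polynomial in T that acts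
    as c on each primary component V_c ([primary_interpolation]). It is
    isometric by orthogonality and surjective because its eigenvalues are
    nonzero, hence unitary, and T - U is nilpotent since it acts as T - c on
    V_c. For the last assertion, D_m = 0 implies D_k = 0 for all k >= m, so T
    is (2 m - 1)-isometric, and one can take m0 = 1 and n = m. *)

(** * Iterated differences of nonnegative sequences *)

Section Backward.
Import Order.TTheory GRing.Theory Num.Theory.

(** [h k] is the k-th backward difference of [h 0]: a nonnegative sequence
    cannot have an m-th difference bounded above by a negative constant. *)
Lemma backward_differences_ge0 (R : realType) (h : nat -> nat -> R) (m : nat) (b : R) :
  (forall k n, h k.+1 n.+1 = h k n.+1 - h k n) ->
  (forall n, 0 <= h 0 n) ->
  (forall n, h m n <= b) -> 0 <= b.
Proof.
move=> hS h0 hm; rewrite leNgt; apply/negP => b0.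
(* In the induction on m, lower differences are only bounded from some rank
   on. *)
have {hm} : forall n, (0 <= n)%N -> h m n <= b by [].
elim: m (0%N) b b0 => [|m IH] n0 b b0 hb.
  by have := lt_le_trans (le_lt_trans (hb n0 (leqnn _)) b0) (h0 n0); rewrite ltxx.
have step p : h m (n0 + p)%N <= h m n0 + b *+ p.
  elim: p => [|p IHp]; first by rewrite addn0 mulr0n addr0.
  rewrite addnS mulrS addrCA -[h m _](subrK (h m (n0 + p)%N)) -hS lerD//.
  by apply: hb; rewrite -addnS leq_addr.
pose p := Num.Def.archi_bound ((`|h m n0| + 1) / - b).
have pb : h m n0 + b *+ p <= -1.
  have : (`|h m n0| + 1) / - b < p%:R.
    by apply: archi_boundP; rewrite divr_ge0 ?oppr_ge0 ?addr_ge0// ltW.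
  rewrite ltr_pdivrMr ?oppr_gt0// -mulr_natr.
  by have := ler_norm (h m n0); lra.
apply: (IH (n0 + p)%N (-1)) => [|n /subnKC <-]; first by rewrite ltrN10.
apply: le_trans pb; rewrite -addnA; apply: le_trans (step _) _.
rewrite lerD2l -[leRHS]addr0 mulrnDr lerD2l.
by rewrite mulrn_wle0// ltW.
Qed.

End Backward.

(** * The forms associated with the operator differences *)

Section Form.
Import Order.TTheory GRing.Theory Num.Theory.
Local Open Scope complex_scope.
Local Open Scope ring_scope.
Context {R : realType} {H : hilbertType R}.
Implicit Types (x y z : H) (a b c : R[i]).

Lemma innerDl x y z : inner (x + y) z = inner x z + inner y z.
Proof. exact: linearDl. Qed.
Lemma innerDr x y z : inner z (x + y) = inner z x + inner z y.
Proof. exact: linearDr. Qed.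
Lemma innerZl a x y : inner (a *: x) y = a * inner x y.
Proof. exact: linearZl_LR. Qed.
Lemma innerZr a x y : inner x (a *: y) = a^* * inner x y.
Proof. exact: linearZr_LR. Qed.
Lemma inner0l x : inner 0 x = 0.
Proof. exact: linear0l. Qed.
Lemma inner0r x : inner x 0 = 0.
Proof. exact: linear0r. Qed.
Lemma inner_conj x y : inner y x = (inner x y)^*.
Proof. by rewrite hermC expr0 mul1r. Qed.

Lemma inner_suml (I : Type) (r : seq I) (F : I -> H) y :
  inner (\sum_(i <- r) F i) y = \sum_(i <- r) inner (F i) y.
Proof. by apply: (big_morph (fun x => inner x y)) => [u v|]; rewrite ?innerDl ?inner0l. Qed.

Variable T : bop H.

(** The Hermitian form B_k(x, y) = <D_k x, y>, where D_k is the k-th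
    difference [bop_triangle k T]. *)
Definition tform k x y : R[i] := inner (bop_triangle k T x) y.

Lemma bop_sumE (I : Type) (r : seq I) (F : I -> bop H) x :
  (\sum_(i <- r) F i) x = \sum_(i <- r) F i x.
Proof. by elim/big_rec2 : _ => // i ? ? _ <-. Qed.

Lemma bopDE (A B : bop H) x : (A + B) x = A x + B x. Proof. by []. Qed.
Lemma bopZE a (A : bop H) x : (a *: A) x = a *: A x. Proof. by []. Qed.
Lemma bopME (A B : bop H) x : (A * B) x = A (B x). Proof. by []. Qed.

Lemma bopSr j (A : bop H) x : (A ^+ j.+1) x = (A ^+ j) (A x).
Proof. by rewrite exprSr. Qed.

Lemma inner_adjointl x y : inner (adjoint T x) y = inner x (T y).
Proof. by rewrite inner_conj -adjointP -inner_conj. Qed.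

Lemma inner_adjointX j x y : inner ((adjoint T ^+ j) x) y = inner x ((T ^+ j) y).
Proof.
elim: j x y => // j IH x y.
by rewrite exprSr bopME IH inner_adjointl exprS bopME.
Qed.

Lemma tformE k x y : tform k x y =
  \sum_(j < k.+1) (-1) ^+ j * 'C(k, j)%:R * inner ((T ^+ j) x) ((T ^+ j) y).
Proof.
rewrite /tform /bop_triangle bop_sumE inner_suml; apply: eq_bigr => j _.
by rewrite bopZE bopME innerZl inner_adjointX.
Qed.

Lemma tform0 x y : tform 0 x y = inner x y.
Proof. by rewrite tformE big_ord1 expr0 bin0 !mul1r. Qed.

Lemma tformS k x y : tform k.+1 x y = tform k x y - tform k (T x) (T y).
Proof.
rewrite !tformE big_ord_recl [in RHS]big_ord_recl/= !bin0 -addrA; congr (_ + _).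
rewrite big_ord_recr [X in _ - X]big_ord_recr/= !binn opprD addrA; congr (_ + _).
  by rewrite -sumrB; apply: eq_bigr => i _;
    rewrite /bump/= add1n binS natrD !bopSr exprS; ring.
by rewrite /bump/= add1n !bopSr exprS; ring.
Qed.

Lemma tformDl k x y z : tform k (x + y) z = tform k x z + tform k y z.
Proof. by rewrite /tform linearD innerDl. Qed.
Lemma tformDr k x y z : tform k z (x + y) = tform k z x + tform k z y.
Proof. by rewrite /tform innerDr. Qed.
Lemma tformZl k a x y : tform k (a *: x) y = a * tform k x y.
Proof. by rewrite /tform linearZ innerZl. Qed.
Lemma tformZr k a x y : tform k x (a *: y) = a^* * tform k x y.
Proof. by rewrite /tform innerZr. Qed.
Lemma tform_conj k x y : tform k y x = (tform k x y)^*.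
Proof.
elim: k x y => [|k IH] x y; first by rewrite !tform0 inner_conj.
by rewrite !tformS !(IH x) (IH (T x)) rmorphB.
Qed.

(** If B_k is negative semidefinite, its isotropic vectors are in its kernel
    (the equality case of the Cauchy-Schwarz inequality). *)
Lemma tform_kernel k x :
  (forall y, tform k y y <= 0) -> tform k x x = 0 -> forall y, tform k x y = 0.
Proof.
move=> neg xx y; set b := tform k x y.
pose s := (1 - tform k y y)^-1.
have yy := neg y.
have s0 : 0 < 1 - tform k y y by rewrite subr_gt0 (le_lt_trans yy).
have sR : s^* = s by rewrite conj_Creal// realV gtr0_real.
(* With b = B_k(x, y) and s = 1 / (1 - B_k(y, y)), the value of the form at
   x + s b y is s^2 |b|^2 (2 - B_k(y, y)), which is positive unless b = 0. *)
have := neg (x + (s * b) *: y).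
rewrite tformDl !tformDr !tformZl !tformZr xx (tform_conj k x y) -/b add0r.
rewrite rmorphM/= sR.
have -> : s * b^* * b + (s * b * b^* + s * b * (s * b^* * tform k y y)) =
    s ^+ 2 * (b * b^*) * (2 - tform k y y).
  have -> : tform k y y = 1 - s^-1 by rewrite /s invrK; ring.
  by field; rewrite invr_neq0// gt_eqF.
rewrite -normCK pmulr_lle0; last first.
  by rewrite subr_gt0 (le_lt_trans yy).
rewrite pmulr_rle0 ?exprn_gt0 ?invr_gt0// -normrX normr_le0 expf_eq0/=.
by move/eqP.
Qed.

End Form.

(** * Polynomials in an operator and generalized eigenspaces *)

Section FunctionalCalculus.
Import Order.TTheory GRing.Theory Num.Theory.
Local Open Scope complex_scope.
Local Open Scope ring_scope.
Context {R : realType} {H : hilbertType R}.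
Variable T : bop H.
Implicit Types (p q : {poly R[i]}) (c : R[i]).

Lemma bop_horner_widen n p :
  (size p <= n)%N -> bop_horner p T = \sum_(i < n) p`_i *: T ^+ i.
Proof.
move=> pn; rewrite /bop_horner (big_ord_widen n (fun i => p`_i *: T ^+ i) pn).
rewrite big_mkcond/=; apply: eq_bigr => i _; case: ifPn => //.
by rewrite -leqNgt => pi; rewrite nth_default// scale0r.
Qed.

Lemma bop_hornerD p q : bop_horner (p + q) T = bop_horner p T + bop_horner q T.
Proof.
pose n := maxn (size p) (size q).
rewrite !(@bop_horner_widen n) ?leq_maxl ?leq_maxr ?(leq_trans (size_polyD _ _))//.
by rewrite -big_split/=; apply: eq_bigr => i _; rewrite coefD scalerDl.
Qed.

Lemma bop_hornerC c : bop_horner c%:P T = c *: (1 : bop H).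
Proof.
by rewrite (@bop_horner_widen 1) ?size_polyC_leq1// big_ord1 coefC/= expr0.
Qed.

Lemma bop_hornerMX p : bop_horner (p * 'X) T = bop_horner p T * T.
Proof.
rewrite (@bop_horner_widen (size p).+1); last first.
  by rewrite (leq_trans (size_polyMleq _ _))// size_polyX addn2.
rewrite big_ord_recl coefMX/= scale0r add0r /bop_horner mulr_suml.
by apply: eq_bigr => i _; rewrite coefMX/= -bop_scaleAl -exprSr.
Qed.

Lemma bop_hornerM p q : bop_horner (p * q) T = bop_horner p T * bop_horner q T.
Proof.
elim/poly_ind: q => [|q c IH].
  by rewrite mulr0 bop_hornerC scale0r mulr0.
rewrite mulrDr mulrA !bop_hornerD !bop_hornerMX IH mulrDr mulrA; congr (_ + _).
rewrite mulrC bop_hornerC -bop_scaleAr mulr1.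
elim/poly_ind: p {IH} => [|p d IH].
  by rewrite mulr0 bop_hornerC !scale0r scaler0.
rewrite mulrDr mulrA !bop_hornerD !bop_hornerMX IH -polyCM !bop_hornerC.
by rewrite scalerDr scalerA bop_scaleAl.
Qed.

Lemma bop_hornerXsubC c : bop_horner ('X - c%:P) T = T - c *: (1 : bop H).
Proof.
rewrite -[X in X - _]mul1r -polyCN bop_hornerD bop_hornerMX !bop_hornerC.
by rewrite scale1r mul1r scaleNr.
Qed.

Lemma bop_hornerXn p k : bop_horner (p ^+ k) T = bop_horner p T ^+ k.
Proof.
elim: k => [|k IH]; first by rewrite !expr0 bop_hornerC scale1r.
by rewrite !exprS bop_hornerM IH.
Qed.

Lemma bop_horner_comm p q :
  bop_horner p T * bop_horner q T = bop_horner q T * bop_horner p T.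
Proof. by rewrite -!bop_hornerM mulrC. Qed.

Lemma bop_hornerX : bop_horner 'X T = T.
Proof. by rewrite -['X]mul1r bop_hornerMX bop_hornerC scale1r mul1r. Qed.

(** [gker c k x]: x is in the generalized eigenspace ker (T - c)^k. *)
Definition gker c k (x : H) : Prop := ((T - c *: (1 : bop H)) ^+ k) x = 0.

Lemma gker_horner c k x : gker c k x <-> bop_horner (('X - c%:P) ^+ k) T x = 0.
Proof. by rewrite bop_hornerXn bop_hornerXsubC. Qed.

Lemma gker0 c x : gker c 0 x <-> x = 0. Proof. by []. Qed.

Lemma gkerS c k x : gker c k.+1 x <-> gker c k (T x - c *: x).
Proof. by rewrite /gker bopSr. Qed.

Lemma gker_leq c j k x : (j <= k)%N -> gker c j x -> gker c k x.
Proof.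
by move=> /subnK <- jx; rewrite /gker exprD bopME (jx : _ = 0) linear0.
Qed.

Lemma gkerZ c k a x : gker c k x -> gker c k (a *: x).
Proof.
by rewrite /gker; set L := (_ ^+ _ : bop H) => xk; rewrite linearZ/= xk scaler0.
Qed.

Lemma gkerB c k x y : gker c k x -> gker c k y -> gker c k (x - y).
Proof.
rewrite /gker; set L := (_ ^+ _ : bop H) => xk yk.
by rewrite (linearB (L : {linear H -> H})) /= xk yk subr0.
Qed.

Lemma gker_stable c k x : gker c k x -> gker c k (T x).
Proof.
move=> /gker_horner kx; apply/gker_horner.
have -> : T x = bop_horner 'X T x by rewrite bop_hornerX.
by rewrite -bopME bop_horner_comm bopME kx linear0.
Qed.

(** T maps ker (T - c)^k onto itself when c is nonzero. *)
Lemma gker_preimage c k x : c != 0 -> gker c k x -> exists2 y, gker c k y & T y = x.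
Proof.
move=> c0; elim: k x => [|k IH] x.
  by move=> /gker0 ->; exists 0; rewrite ?linear0//; exact: linear0.
move=> /[dup] xk /gkerS /[dup] zk /IH[y yk Ty].
exists (c^-1 *: (x - y)).
  by apply/gkerZ/gkerB => //; exact: gker_leq yk.
by rewrite linearZ/= linearB/= Ty opprB addrC subrK scalerA mulVf// scale1r.
Qed.

Lemma gker_eigenvector c k x : gker c k x -> x = 0 \/ exists2 v, v != 0 & T v = c *: v.
Proof.
elim: k x => [|k IH] x; first by left.
move=> /gkerS/IH[/eqP|]; last by right.
rewrite subr_eq0 => /eqP Tx.
by have [|x0] := eqVneq x 0; [left|right; exists x].
Qed.

End FunctionalCalculus.

(** * Primary decomposition *)

Section Primary.
Import Order.TTheory GRing.Theory Num.Theory.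
Local Open Scope complex_scope.
Local Open Scope ring_scope.
Context {R : realType} {H : hilbertType R}.
Variable T : bop H.

Lemma Bezout_eq1 (F : fieldType) (p q : {poly F}) : coprimep p q ->
  exists u v, u * p + v * q = 1.
Proof.
move=> /Bezout_coprimepP[[u v]/=]; rewrite -size_poly_eq1 => /size_poly1P[d d0 E].
exists (d^-1%:P * u), (d^-1%:P * v).
by rewrite -!mulrA -mulrDr E -polyCM mulVf.
Qed.

Lemma coprimep_primary (s : seq R[i]) e c : c \notin s ->
  coprimep (('X - c%:P) ^+ e c) (\prod_(z <- s) ('X - z%:P) ^+ e z).
Proof.
elim: s => [|z s IH]; first by rewrite big_nil coprimep1.
rewrite inE negb_or => /andP[cz cs]; rewrite big_cons coprimepMr IH// andbT.
by rewrite coprimep_expl// coprimep_expr// coprimep_XsubC2// subr_eq0 eq_sym.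
Qed.

(** The primary decomposition theorem, as an induction principle: the kernel of
    Q(T), where Q is the product of the ('X - c)^(e c) for c in s, is the sum
    of the ker (T - c)^(e c). *)
Lemma primary_ind (s : seq R[i]) (e : R[i] -> nat) (P : H -> Prop) :
  uniq s -> P 0 -> (forall x y, P x -> P y -> P (x + y)) ->
  (forall c x, c \in s -> gker T c (e c) x -> P x) ->
  forall x, bop_horner (\prod_(z <- s) ('X - z%:P) ^+ e z) T x = 0 -> P x.
Proof.
move=> us P0 PD; elim: s us => [|c s IH] /= us Ps x.
  by rewrite big_nil bop_hornerC scale1r => x0; rewrite (x0 : x = 0).
case/andP: us => cs us; rewrite big_cons => Qx.
have [u [v uv]] := Bezout_eq1 _ _ _ (coprimep_primary s e c cs).
set p := ('X - _) ^+ _ in uv Qx; set q := \prod_(_ <- _) _ in uv Qx IH.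
have -> : x = bop_horner (u * p) T x + bop_horner (v * q) T x.
  by rewrite -bopDE -bop_hornerD uv bop_hornerC scale1r.
apply: PD.
  apply: IH => // [d y ds|]; first by apply: Ps; rewrite inE ds orbT.
  rewrite -bopME -bop_hornerM (_ : q * (u * p) = u * (p * q)); last by ring.
  by rewrite bop_hornerM bopME Qx linear0.
apply: (Ps c); rewrite ?mem_head//; apply/gker_horner.
rewrite -bopME -bop_hornerM (_ : _ * (v * q) = v * (p * q)); last by rewrite /p; ring.
by rewrite bop_hornerM bopME Qx linear0.
Qed.

(** By the Chinese remainder theorem, some polynomial in T acts as the scalar c
    on ker (T - c)^(e c) for each c in s. *)
Lemma primary_interpolation (s : seq R[i]) (e : R[i] -> nat) : uniq s ->
  exists p : {poly R[i]}, forall c k x, c \in s -> (k <= e c)%N -> gker T c k x ->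
    bop_horner p T x = c *: x.
Proof.
elim: s => [|c s IH] /=; first by exists 0.
move=> /andP[cs /IH[p ps]].
have [u [v uv]] := Bezout_eq1 _ _ _ (coprimep_primary s e c cs).
set pc := ('X - _) ^+ _ in uv; set q := \prod_(_ <- _) _ in uv.
exists (p * (u * pc) + c%:P * (v * q)) => d k x ds ke /(gker_leq _ _ _ _ _ ke) xk.
have E : bop_horner (u * pc) T x + bop_horner (v * q) T x = x.
  by rewrite -bopDE -bop_hornerD uv bop_hornerC scale1r.
rewrite bop_hornerD !(bop_hornerM T p) (bop_hornerM T c%:P) bop_hornerC bopDE !bopME bopZE.
move: ds; rewrite inE => /predU1P[dc|ds].
  move: xk E; rewrite dc => /gker_horner xk.
  have -> : bop_horner (u * pc) T x = 0 by rewrite bop_hornerM bopME xk linear0.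
  by rewrite add0r linear0 add0r => ->.
have q0 : bop_horner (v * q) T x = 0.
  rewrite bop_hornerM bopME /q (big_rem d)//= mulrC bop_hornerM bopME.
  by move/gker_horner: xk => ->; rewrite !linear0.
by move: E; rewrite !q0 addr0 => ->; rewrite scaler0 addr0 (ps d (e d)).
Qed.

Lemma algebraic_primary : bop_algebraic T ->
  exists (s : seq R[i]) (e : R[i] -> nat), uniq s /\
    bop_horner (\prod_(z <- s) ('X - z%:P) ^+ e z) T = 0.
Proof.
move=> [q q0 qT]; have [r qE] := closed_field_poly_normal q.
exists (undup r), (fun z => count_mem z r); split; first exact: undup_uniq.
have l0 : lead_coef q != 0 by rewrite lead_coef_eq0.
rewrite prodr_undup_exp_count -[LHS]scale1r -(mulVf l0) -scalerA.
move: qT; rewrite {1}qE -mul_polyC bop_hornerM bop_hornerC -bop_scaleAl mul1r => ->.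
by rewrite scaler0.
Qed.

End Primary.

(** * Generalized eigenvectors of expansive operators *)

Section Expansive.
Import Order.TTheory GRing.Theory Num.Theory.
Local Open Scope complex_scope.
Local Open Scope ring_scope.
Context {R : realType} {H : hilbertType R}.
Variable T : bop H.
Implicit Types (a b c : R[i]) (x y v : H).

Lemma tform_eigenvector k c (v : H) : T v = c *: v ->
  tform T k v v = (1 - `|c| ^+ 2) ^+ k * `|v| ^+ 2.
Proof.
move=> Tv; elim: k => [|k IH]; first by rewrite tform0 inner_xx expr0 mul1r.
rewrite tformS Tv tformZl tformZr IH normCK (exprS _ k).
by ring.
Qed.

Lemma eigenvalue_spectrum c (v : H) : v != 0 -> T v = c *: v -> bop_spectrum T c.
Proof.
move=> v0 Tv [S [ST _]]; move/negP: v0; apply; apply/eqP.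
have -> : v = (S * (T - c *: (1 : bop H))) v by rewrite ST.
have E : (T - c *: (1 : bop H)) v = T v - c *: v by [].
by rewrite bopME E Tv subrr linear0.
Qed.

Lemma spectral_radius_ge c : bop_spectrum T c ->
  (spectral_radius T <= 1%:E)%E -> `|c| <= 1.
Proof.
move=> cT rT; rewrite -[`|c|]RRe_real ?normr_real// lecR -lee_fin.
by apply: le_trans rT; apply: ereal_sup_ubound; exists c.
Qed.

Lemma expansive_eigenvalue m c (v : H) : k_expansive m T ->
  v != 0 -> T v = c *: v -> `|c| <= 1 -> `|c| = 1.
Proof.
move=> mT v0 Tv c1; have := mT v; rewrite -/(tform T m v v) (tform_eigenvector m c)//.
rewrite pmulr_lle0 ?exprn_gt0 ?normr_gt0// => le0.
have c2 : 0 <= 1 - `|c| ^+ 2 by rewrite subr_ge0 expr_le1.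
have : (1 - `|c| ^+ 2) ^+ m == 0 by rewrite eq_le le0 exprn_ge0.
rewrite expf_eq0 subr_eq0 => /andP[_]; rewrite eq_sym sqrf_eq1.
case/orP => /eqP// cN1; have := normr_ge0 c.
by rewrite cN1 oppr_ge0 ler10.
Qed.

(** Generalized eigenvectors for unimodular c are in the kernel of B_m. *)
Lemma tform_gker m c k (x y : H) : (forall z, tform T m z z <= 0) ->
  `|c| = 1 -> gker T c k x -> tform T m x y = 0.
Proof.
move=> neg c1; elim: k x y => [|k IH] x y.
  by move=> /gker0 ->; rewrite -(scale0r 0) tformZl mul0r.
move=> xk; apply: tform_kernel => //; apply/eqP.
have c0 : c != 0 by rewrite -normr_eq0 c1 oner_eq0.
(* T z = c z + u with u in ker (T - c)^k, which is in the kernel of B_m. *)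
have tT z : gker T c k.+1 z -> tform T m (T z) (T z) = tform T m z z.
  move=> /gkerS zk; rewrite -[T z](subrK (c *: z)).
  set u := T z - _ in zk *.
  rewrite tformDl [X in X + _]IH// add0r tformDr [X in X + _]tform_conj IH//.
  by rewrite conjC0 add0r tformZl tformZr mulrA -normCK c1 expr1n mul1r.
(* g is a right inverse of T on ker (T - c)^(k+1), so that the iter n g x are a
   backward orbit of x. *)
have /choice[g gP] : forall z, exists w, gker T c k.+1 z -> gker T c k.+1 w /\ T w = z.
  move=> z; have [zk|nzk] := pselect (gker T c k.+1 z); last by exists 0.
  by have [w wk Tw] := gker_preimage T c k.+1 z c0 zk; exists w.
have gk n : gker T c k.+1 (iter n g x).
  by elim: n => // n /gP[].
have Tg n : T (iter n.+1 g x) = iter n g x by have [] := gP _ (gk n).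
have cst n : tform T m (iter n g x) (iter n g x) = tform T m x x.
  by elim: n => // n <-; rewrite -(tT _ (gk n.+1)) Tg.
rewrite eq_le neg/=.
have tR z : (complex.Re (tform T m z z))%:C = tform T m z z.
  by rewrite RRe_real// ler0_real.
rewrite -tR (_ : 0 = (0 : R)%:C)// lecR.
apply: (backward_differences_ge0 R
  (fun j n => complex.Re (tform T j (iter n g x) (iter n g x))) m) => [j n|n|n].
- by rewrite tformS Tg raddfB.
- by rewrite tform0 inner_xx -lecR RRe_real ?exprn_ge0// ger0_real// exprn_ge0.
- by rewrite cst.
Qed.

(** For an m-isometry, generalized eigenspaces for distinct unimodular numbers
    are orthogonal. *)
Lemma gker_orthogonal m a b i j (x y : H) : (forall u v, tform T m u v = 0) ->
  `|a| = 1 -> `|b| = 1 -> a != b ->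
  gker T a i x -> gker T b j y -> inner x y = 0.
Proof.
move=> t0 a1 b1 ab.
have [n] := ubnP (i + j); elim: n i j x y => // n IH i j x y ijn xi yj.
case: i => [|i] in ijn xi *; first by rewrite (gker0 T a x).1// inner0l.
case: j => [|j] in ijn yj *; first by rewrite (gker0 T b y).1// inner0r.
move: ijn; rewrite ltnS addSn addnS => ijn.
have orth k i' j' (u v : H) : (i' + j' < n)%N -> gker T a i' u -> gker T b j' v ->
    tform T k u v = 0.
  move=> ij'; elim: k u v => [|k IHk] u v ui vj; first by rewrite tform0 (IH i' j').
  by rewrite tformS !IHk ?subrr//; exact: gker_stable.
have /gkerS := xi; have /gkerS := yj.
have Tx : T x = (T x - a *: x) + a *: x by rewrite subrK.
have Ty : T y = (T y - b *: y) + b *: y by rewrite subrK.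
move: (T x - a *: x) (T y - b *: y) Tx Ty => u v Tx Ty vj ui.
have ij1 : (i + j.+1 < n)%N by rewrite addnS.
have ij2 : (i.+1 + j < n)%N by rewrite addSn.
have ij3 : (i + j < n)%N by exact: ltnW.
(* By orth, T x and T y can be replaced with a x and b y in all the forms. *)
have w k : tform T k x y = (1 - a * b^*) ^+ k * inner x y.
  elim: k => [|k IHk]; first by rewrite tform0 expr0 mul1r.
  rewrite tformS Tx Ty tformDl !tformDr !tformZl !tformZr.
  rewrite (orth k i j _ _ ij3 ui vj) (orth k i j.+1 _ _ ij1 ui yj).
  rewrite (orth k i.+1 j _ _ ij2 xi vj) IHk (exprS _ k).
  by ring.
have := t0 x y; rewrite w => /eqP; rewrite mulf_eq0 expf_eq0 => /orP[/andP[_]|/eqP//].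
rewrite subr_eq0 => /eqP ab1; case/negP: ab; apply/eqP.
by rewrite -[b]mul1r ab1 -mulrA [_ * b]mulrC -normCK b1 expr1n mulr1.
Qed.

Lemma tform0_isometric k : (forall u v, tform T k u v = 0) -> k_isometric k T.
Proof.
move=> t0; apply: bopE => x; apply/eqP; rewrite -normr_eq0 -sqrf_eq0 -inner_xx.
by rewrite [X in X == _]t0.
Qed.

End Expansive.

(** * Algebraic expansive operators *)

Section AlgebraicExpansive.
Import Order.TTheory GRing.Theory Num.Theory.
Local Open Scope complex_scope.
Local Open Scope ring_scope.
Context {R : realType} {H : hilbertType R}.

Lemma isometry_onto_unitary (U : bop H) :
  (forall x y, inner (U x) (U y) = inner x y) ->
  (forall x, exists z, U z = x) -> bop_unitary U.
Proof.
move=> iso onto.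
have UU x : adjoint U (U x) = x.
  by apply: inner_inj => y; rewrite -adjointP iso.
by split; apply: bopE => x; rewrite bopME ?UU//; have [z <-] := onto x; rewrite UU.
Qed.

Context (m : nat) (T : bop H).

Lemma gker_unimodular
    (expT : k_expansive m T) (rT : (spectral_radius T <= 1%:E)%E) (c : R[i]) k x :
  gker T c k x -> x = 0 \/ `|c| = 1.
Proof.
move=> /gker_eigenvector[|[v v0 Tv]]; [by left|right].
apply: (expansive_eigenvalue T m c v) => //.
by apply: spectral_radius_ge rT; exact: eigenvalue_spectrum Tv.
Qed.

(** An algebraic m-expansive operator of spectral radius at most 1 is
    m-isometric. *)
Lemma algebraic_expansive_tform0 (algT : bop_algebraic T)
    (expT : k_expansive m T) (rT : (spectral_radius T <= 1%:E)%E) x y :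
  tform T m x y = 0.
Proof.
have [s [e [us sT]]] := algebraic_primary T algT.
have Q0 x' : bop_horner (\prod_(z <- s) ('X - z%:P) ^+ e z) T x' = 0 by rewrite sT.
apply: (primary_ind T s e (fun x => tform T m x y = 0) us _ _ _ x (Q0 x)).
- by rewrite -(scale0r 0) tformZl mul0r.
- by move=> u v u0 v0; rewrite tformDl u0 v0 addr0.
move=> c {}x _ xc; have [->|c1] := gker_unimodular expT rT c _ x xc.
  by rewrite -(scale0r 0) tformZl mul0r.
exact: (tform_gker T m c (e c) x y expT c1 xc).
Qed.

Lemma algebraic_expansive_unitary_nilpotent (algT : bop_algebraic T)
    (expT : k_expansive m T) (rT : (spectral_radius T <= 1%:E)%E) :
  exists U N : bop H,
  [/\ bop_unitary U, bop_nilpotent N, U * N = N * U & T = U + N].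
Proof.
have [s [e [us sT]]] := algebraic_primary T algT.
have ind P := fun P0 PD PV x =>
  primary_ind T s e P us P0 PD PV x (congr1 (fun A : bop H => A x) sT).
have [p pE] := primary_interpolation T s e us.
pose U := bop_horner p T; pose N := T - U.
have UN : U * N = N * U.
  have := bop_horner_comm T p 'X; rewrite bop_hornerX -/U => UT.
  by rewrite mulrBr mulrBl UT.
exists U, N; split=> //; last by rewrite addrC subrK.
- apply: isometry_onto_unitary => [x y|].
    apply: (ind (fun x => inner (U x) (U y) = inner x y)).
    + by rewrite linear0 !inner0l.
    + by move=> u v uy vy; rewrite linearD/= !innerDl uy vy.
    move=> a {}x sa xa.
    apply: (ind (fun y => inner (U x) (U y) = inner x y)).
    + by rewrite linear0 !inner0r.
    + by move=> u v uy vy; rewrite linearD/= !innerDr uy vy.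
    move=> b {}y sb yb.
    have [->|a1] := gker_unimodular expT rT a _ x xa; first by rewrite linear0 !inner0l.
    have [->|b1] := gker_unimodular expT rT b _ y yb; first by rewrite linear0 !inner0r.
    rewrite /U (pE a (e a) x)// (pE b (e b) y)// innerZl innerZr.
    have [ab|ab] := eqVneq a b; first by rewrite -ab mulrA -normCK a1 expr1n mul1r.
    have t0 := algebraic_expansive_tform0 algT expT rT.
    rewrite (gker_orthogonal T m a b (e a) (e b) x y t0 a1)//.
    by rewrite !mulr0.
  apply: ind.
  + by exists 0; rewrite linear0.
  + by move=> u v [u' <-] [v' <-]; exists (u' + v'); rewrite linearD.
  move=> c x sc xc; have [->|c1] := gker_unimodular expT rT c _ x xc.
    by exists 0; rewrite linear0.
  exists (c^-1 *: x); rewrite linearZ/= /U (pE c (e c) x)// scalerA mulVf ?scale1r//.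
  by rewrite -normr_eq0 c1 oner_eq0.
(* N acts as T - c on ker (T - c)^(e c). *)
have NE c k x : c \in s -> (k <= e c)%N -> gker T c k x -> (N ^+ k) x = 0.
  move=> sc; elim: k x => // k IH x ke /[dup] xk /gkerS xk'.
  rewrite bopSr; have -> : N x = T x - c *: x by rewrite -(pE c k.+1 x).
  by apply: IH => //; exact: ltnW.
exists (\max_(c <- s) e c); apply: bopE; apply: ind.
- by rewrite linear0.
- by move=> u v u0 v0; rewrite linearD/= u0 v0 addr0.
move=> c x sc xc; have /subnK <- := @leq_bigmax_seq _ s xpredT e c sc isT.
by rewrite exprD bopME (NE c (e c) x)// linear0.
Qed.

End AlgebraicExpansive.

Theorem theorem4p1 (R : realType) (H : hilbertType R) (m : nat) (T : bop H) :
  infinite_dimensional H ->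
  (1 <= m)%N ->
  bop_algebraic T ->
  k_expansive m T ->
  (spectral_radius T <= 1%:E)%E ->
  (exists U N : bop H,
     [/\ bop_unitary U, bop_nilpotent N, U * N = N * U & T = U + N])
  /\
  (exists m0 n : nat,
     [/\ (0 < m0 <= m)%N, odd m0, (0 < n)%N, ((m0 + 1) %/ 2 <= n)%N
       & k_isometric (2 * n - 1)%N T]).
Proof.
move=> _ m1 algT expT rT; split.
  exact: algebraic_expansive_unitary_nilpotent algT expT rT.
exists 1%N, m; split=> //; apply: tform0_isometric.
have t0 := algebraic_expansive_tform0 m T algT expT rT.
have mk k x y : tform T (k + m) x y = 0.
  by elim: k x y => // k IH x y; rewrite addSn tformS !IH GRing.subrr.
rewrite -(@subnK m (2 * m - 1)) ?mul2n -?addnn; first exact: mk.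
by rewrite -addnBA// leq_addr.
Qed.
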